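(* Let $(A,\cdot,[\cdot,\cdot],\alpha)$ be a Hom-$F$-manifold algebra and $T:V\to A$ an $\mathcal O$-operator on $A$ with respect to a representation $(V;\rho,\mu,\phi)$. Define operations $\diamond$ and $\ast$ on $V$ by $$u\diamond v=\mu(T(u))v,\qquad u\ast v=\rho(T(u))v,\qquad u,v\in V.$$ Then $(V,\diamond,\ast,\phi)$ is a Hom-pre-$F$-manifold algebra, and $T$ is a homomorphism of Hom-$F$-manifold algebras from the sub-adjacent Hom-$F$-manifold algebra $V^c$ of $(V,\diamond,\ast,\phi)$ to $(A,\cdot,[\cdot,\cdot],\alpha)$.
   Context: All vector spaces are over an algebraically closed field $\mathbb K$ of characteristic $0$; twist maps are linear. A Hom-$F$-manifold algebra is a tuple $(A,\cdot,[\cdot,\cdot],\alpha)$ such that: $\cdot$ is bilinear, commutative and $\alpha(x)\cdot(y\cdot z)=(x\cdot y)\cdot\alpha(z)$ (commutative Hom-associative algebra); $[\cdot,\cdot]$ is bilinear, skew-symmetric and $[\alpha(x),[y,z]]+[\alpha(y),[z,x]]+[\alpha(z),[x,y]]=0$ (Hom-Lie algebra); and $\mathcal L(x\cdot y,\alpha(z),\alpha(w))=\alpha^2(x)\cdot\mathcal L(y,z,w)+\alpha^2(y)\cdot\mathcal L(x,z,w)$, where $\mathcal L(x,y,z)=[\alpha(x),y\cdot z]-[x,y]\cdot\alpha(z)-\alpha(y)\cdot[x,z]$. A homomorphism $\varphi:(A,\cdot_A,[\cdot,\cdot]_A,\alpha_A)\to(B,\cdot_B,[\cdot,\cdot]_B,\alpha_B)$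 is a linear map with $\varphi\alpha_A=\alpha_B\varphi$, $\varphi(x\cdot_Ay)=\varphi(x)\cdot_B\varphi(y)$, $\varphi([x,y]_A)=[\varphi(x),\varphi(y)]_B$. A representation of a Hom-$F$-manifold algebra $A$ is $(V;\rho,\mu,\phi)$ with $\rho,\mu:A\to\mathfrak{gl}(V)$ linear and $\phi\in\mathfrak{gl}(V)$ such that: $\mu(\alpha(x))\phi=\phi\mu(x)$, $\mu(x\cdot y)\phi=\mu(\alpha(x))\mu(y)$; $\rho(\alpha(x))\phi=\phi\rho(x)$, $\rho([x,y])\phi=\rho(\alpha(x))\rho(y)-\rho(\alpha(y))\rho(x)$; and for all $x,y,z\in A$, $u\in V$ $$\mathcal L_1(x\cdot y,\alpha(z),\phi(u))=\mu(\alpha^2(x))\mathcal L_1(y,z,u)+\mu(\alpha^2(y))\mathcal L_1(x,z,u),$$ $$\mu(\mathcal L(x,y,z))\phi^2(u)=\mathcal L_2(\alpha(y),\alpha(z),\mu(x)(u))-\mu(\alpha^2(x))\mathcal L_2(y,z,u),$$ where $\mathcal L_1(x,y,u)=\rho(\alpha(x))\mu(y)(u)-\mu(\alpha(y))\rho(x)(u)-\mu([x,y])\phi(u)$ and $\mathcal L_2(x,y,u)=\mu(\alpha(x))\rho(y)(u)+\mu(\alpha(y))\rho(x)(u)-\rho(x\cdot y)\phi(u)$. An $\mathcal O$-operator on $A$ with respect to $(V;\rho,\mu,\phi)$ is a linear map $T:V\to A$ with $T\phi=\alpha T$, $T(u)\cdot T(v)=T(\mu(T(u))v+\mu(T(v))u)$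 and $[T(u),T(v)]=T(\rho(T(u))v-\rho(T(v))u)$ for all $u,v\in V$. A Hom-pre-$F$-manifold algebra is a tuple $(B,\diamond,\ast,\beta)$ such that: $\diamond$ is bilinear with $\beta(x)\diamond(y\diamond z)=(y\diamond x)\diamond\beta(z)+(x\diamond y)\diamond\beta(z)$ (Hom-Zinbiel); $\ast$ is bilinear with $(x\ast y)\ast\beta(z)-\beta(x)\ast(y\ast z)=(y\ast x)\ast\beta(z)-\beta(y)\ast(x\ast z)$ (Hom-pre-Lie); and, with $x\cdot y=x\diamond y+y\diamond x$, $[x,y]=x\ast y-y\ast x$, $$F_1(x\cdot y,\beta(z),\beta(w))=\beta^2(x)\diamond F_1(y,z,w)+\beta^2(y)\diamond F_1(x,z,w),$$ $$\mathcal L(x,y,z)\diamond\beta^2(w)=F_2(\beta(y),\beta(z),x\diamond w)-\beta^2(x)\diamond F_2(y,z,w),$$ where $F_1(x,y,z)=\beta(x)\ast(y\diamond z)-\beta(y)\diamond(x\ast z)-[x,y]\diamond\beta(z)$, $F_2(x,y,z)=\beta(x)\diamond(y\ast z)+\beta(y)\diamond(x\ast z)-(x\cdot y)\ast\beta(z)$, $\mathcal L(x,y,z)=[\beta(x),y\cdot z]-[x,y]\cdot\beta(z)-\beta(y)\cdot[x,z]$. Its sub-adjacent Hom-$F$-manifold algebra $B^c$ is $(B,\cdot,[\cdot,\cdot],\beta)$ with these operations $\cdot$ and $[\cdot,\cdot]$. *)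

(* Defs.v *)
From HB Require Import structures.
From mathcomp Require Import all_boot all_order all_algebra.

Set Implicit Arguments.
Unset Strict Implicit.
Unset Printing Implicit Defensive.

Import GRing.Theory.
Local Open Scope ring_scope.

(* A tuple (A, ., [.,.], alpha) is given by a K-vector space A of arbitrary
   dimension and plain functions mul, br : A -> A -> A and alpha : A -> A; the
   records below collect the axioms, including (bi)linearity. *)

Definition is_bilinear (K : fieldType) (U V W : lmodType K) (f : U -> V -> W) :=
  bilinear_for *:%R *:%R f.

Section HomFManifold.
Variables (K : fieldType) (A : lmodType K).
Variables (mul br : A -> A -> A) (alpha : A -> A).

Definition calL (x y z : A) : A :=
  br (alpha x) (mul y z) - mul (br x y) (alpha z) - mul (alpha y) (br x z).

Record comm_hom_assoc : Prop := CommHomAssoc {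
  cha_bilinear : is_bilinear mul;
  cha_comm : forall x y, mul x y = mul y x;
  cha_assoc : forall x y z, mul (alpha x) (mul y z) = mul (mul x y) (alpha z)
}.

Record hom_Lie : Prop := HomLie {
  hl_bilinear : is_bilinear br;
  hl_skew : forall x y, br x y = - br y x;
  hl_jacobi : forall x y z,
    br (alpha x) (br y z) + br (alpha y) (br z x) + br (alpha z) (br x y) = 0
}.

Record hom_F_manifold_algebra : Prop := HomFManifoldAlgebra {
  hF_alpha_linear : linear alpha;
  hF_assoc : comm_hom_assoc;
  hF_Lie : hom_Lie;
  hF_compat : forall x y z w,
    calL (mul x y) (alpha z) (alpha w)
    = mul (alpha (alpha x)) (calL y z w) + mul (alpha (alpha y)) (calL x z w)
}.

End HomFManifold.

Record hom_F_manifold_hom (K : fieldType) (A B : lmodType K)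
    (mulA brA : A -> A -> A) (alphaA : A -> A)
    (mulB brB : B -> B -> B) (alphaB : B -> B) (f : A -> B) : Prop :=
  HomFManifoldHom {
    hFh_linear : linear f;
    hFh_alpha : forall x, f (alphaA x) = alphaB (f x);
    hFh_mul : forall x y, f (mulA x y) = mulB (f x) (f y);
    hFh_br : forall x y, f (brA x y) = brB (f x) (f y)
  }.

Section Representation.
Variables (K : fieldType) (A V : lmodType K).
Variables (mul br : A -> A -> A) (alpha : A -> A).
(* A linear map A -> gl(V) is encoded as a bilinear map A -> V -> V. *)
Variables (rho mu : A -> V -> V) (phi : V -> V).

Definition calL1 (x y : A) (u : V) : V :=
  rho (alpha x) (mu y u) - mu (alpha y) (rho x u) - mu (br x y) (phi u).

Definition calL2 (x y : A) (u : V) : V :=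
  mu (alpha x) (rho y u) + mu (alpha y) (rho x u) - rho (mul x y) (phi u).

Record representation : Prop := Representation {
  rep_rho_bilinear : is_bilinear rho;
  rep_mu_bilinear : is_bilinear mu;
  rep_phi_linear : linear phi;
  rep_mu_phi : forall x u, mu (alpha x) (phi u) = phi (mu x u);
  rep_mu_mul : forall x y u, mu (mul x y) (phi u) = mu (alpha x) (mu y u);
  rep_rho_phi : forall x u, rho (alpha x) (phi u) = phi (rho x u);
  rep_rho_br : forall x y u,
    rho (br x y) (phi u) = rho (alpha x) (rho y u) - rho (alpha y) (rho x u);
  rep_L1 : forall x y z u,
    calL1 (mul x y) (alpha z) (phi u)
    = mu (alpha (alpha x)) (calL1 y z u) + mu (alpha (alpha y)) (calL1 x z u);
  rep_L2 : forall x y z u,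
    mu (calL mul br alpha x y z) (phi (phi u))
    = calL2 (alpha y) (alpha z) (mu x u) - mu (alpha (alpha x)) (calL2 y z u)
}.

Record O_operator (T : V -> A) : Prop := OOperator {
  Oop_linear : linear T;
  Oop_phi : forall u, T (phi u) = alpha (T u);
  Oop_mul : forall u v, mul (T u) (T v) = T (mu (T u) v + mu (T v) u);
  Oop_br : forall u v, br (T u) (T v) = T (rho (T u) v - rho (T v) u)
}.

End Representation.

Section HomPreFManifold.
Variables (K : fieldType) (B : lmodType K).
Variables (dia ast : B -> B -> B) (beta : B -> B).

Definition subadj_mul (x y : B) : B := dia x y + dia y x.
Definition subadj_br (x y : B) : B := ast x y - ast y x.

Definition calF1 (x y z : B) : B :=
  ast (beta x) (dia y z) - dia (beta y) (ast x z) - dia (subadj_br x y) (beta z).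

Definition calF2 (x y z : B) : B :=
  dia (beta x) (ast y z) + dia (beta y) (ast x z) - ast (subadj_mul x y) (beta z).

Record hom_Zinbiel : Prop := HomZinbiel {
  hz_bilinear : is_bilinear dia;
  hz_axiom : forall x y z,
    dia (beta x) (dia y z) = dia (dia y x) (beta z) + dia (dia x y) (beta z)
}.

Record hom_pre_Lie : Prop := HomPreLie {
  hpl_bilinear : is_bilinear ast;
  hpl_axiom : forall x y z,
    ast (ast x y) (beta z) - ast (beta x) (ast y z)
    = ast (ast y x) (beta z) - ast (beta y) (ast x z)
}.

Record hom_pre_F_manifold_algebra : Prop := HomPreFManifoldAlgebra {
  hpF_beta_linear : linear beta;
  hpF_Zinbiel : hom_Zinbiel;
  hpF_pre_Lie : hom_pre_Lie;
  hpF_F1 : forall x y z w,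
    calF1 (subadj_mul x y) (beta z) (beta w)
    = dia (beta (beta x)) (calF1 y z w) + dia (beta (beta y)) (calF1 x z w);
  hpF_F2 : forall x y z w,
    dia (calL subadj_mul subadj_br beta x y z) (beta (beta w))
    = calF2 (beta y) (beta z) (dia x w) - dia (beta (beta x)) (calF2 y z w)
}.

End HomPreFManifold.

(* Main.v *)
(** An O-operator T intertwines the operations u <> v = mu(T u) v and
    u * v = rho(T u) v with those of A, in the sense that T(u.v) = T u . T v and
    T[u,v] = [T u, T v].  Each axiom of a Hom-pre-F-manifold algebra is therefore
    the corresponding representation axiom evaluated at elements T u.
    The sub-adjacent algebra of any Hom-pre-F-manifold algebra is a
    Hom-F-manifold algebra because
    L(x,y,z) = F_1(x,y,z) + F_1(x,z,y) + F_2(y,z,x). *)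
Require Import Defs.
From mathcomp Require Import all_boot all_order all_algebra.

Set Implicit Arguments.
Unset Strict Implicit.
Unset Printing Implicit Defensive.

Import GRing.Theory.
Local Open Scope ring_scope.

Lemma linear_add (K : fieldType) (U V : lmodType K) (f : U -> V) :
  linear f -> {morph f : x y / x + y}.
Proof. by move=> lf x y; have := lf 1 x y; rewrite !scale1r. Qed.

Lemma linear_sub (K : fieldType) (U V : lmodType K) (f : U -> V) :
  linear f -> {morph f : x y / x - y}.
Proof. exact: zmod_morphism_linear. Qed.

Section Bilinear.
Variables (K : fieldType) (U V W : lmodType K).
Variables (f : U -> V -> W) (bf : is_bilinear f).

Lemma bilinear_addl x y z : f (x + y) z = f x z + f y z.
Proof. exact: (@linear_add _ _ _ (f^~ z) (bf.1 z)). Qed.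

Lemma bilinear_subl x y z : f (x - y) z = f x z - f y z.
Proof. exact: (@linear_sub _ _ _ (f^~ z) (bf.1 z)). Qed.

Lemma bilinear_addr x y z : f x (y + z) = f x y + f x z.
Proof. exact: (@linear_add _ _ _ (f x) (bf.2 x)). Qed.

Lemma bilinear_subr x y z : f x (y - z) = f x y - f x z.
Proof. exact: (@linear_sub _ _ _ (f x) (bf.2 x)). Qed.

End Bilinear.

Section Subadjacent.
Variables (K : fieldType) (B : lmodType K).
Variables (dia ast : B -> B -> B) (beta : B -> B).

Local Notation smul := (subadj_mul dia).
Local Notation sbr := (subadj_br ast).

Lemma subadj_mulC x y : smul x y = smul y x.
Proof. exact: addrC. Qed.

Lemma subadj_mul_bilinear : is_bilinear dia -> is_bilinear smul.
Proof.
move=> [dl dr]; split=> [y|x] a u v; rewrite /subadj_mul dl dr /= scalerDr;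
by rewrite addrACA.
Qed.

Lemma subadj_br_bilinear : is_bilinear ast -> is_bilinear sbr.
Proof.
move=> [al ar]; split=> [y|x] a u v; rewrite /subadj_br al ar /= scalerBr;
by rewrite opprD addrACA.
Qed.

(** The double product in [E] is symmetric in [x], [y], [z]; together with commutativity of [smul]
    this yields Hom-associativity. *)
Lemma subadj_comm_hom_assoc :
  hom_Zinbiel dia beta -> comm_hom_assoc smul beta.
Proof.
move=> [bd zin].
have E x y z : smul (beta x) (smul y z)
    = dia (smul x y) (beta z) + dia (smul x z) (beta y)
      + dia (smul y z) (beta x).
  rewrite {1}/subadj_mul {1}[smul y z]/subadj_mul (bilinear_addr bd).
  by rewrite !zin /subadj_mul !(bilinear_addl bd) ![dia (dia x _) _ + _]addrC.
split=> [||x y z]; [exact: subadj_mul_bilinear | exact: subadj_mulC |].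
rewrite (subadj_mulC _ (beta z)) !E (subadj_mulC z x) (subadj_mulC z y).
by rewrite [RHS](ACl (3*1*2)).
Qed.

(** By [E], which rearranges the Hom-pre-Lie axiom, left [ast]-multiplication by a bracket is a
    twisted commutator. Each double bracket is then a difference of two values of [q]. *)
Lemma subadj_hom_Lie : hom_pre_Lie ast beta -> hom_Lie sbr beta.
Proof.
move=> [ba plie].
have E x y z : ast (sbr x y) (beta z)
    = ast (beta x) (ast y z) - ast (beta y) (ast x z).
  rewrite /subadj_br (bilinear_subl ba).
  rewrite -[ast (ast x y) _](subrK (ast (beta x) (ast y z))) plie.
  by rewrite addrC !addrA addNr add0r addrC.
split=> [|x y|x y z]; first exact: subadj_br_bilinear.
  by rewrite /subadj_br opprB.
pose q u v w := ast (beta v) (ast u w) + ast (beta w) (ast u v).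
have qC u v w : q u v w = q u w v by rewrite /q addrC.
have G u v w : sbr (beta u) (sbr v w) = q v u w - q w u v.
  rewrite {1}/subadj_br E {1}/subadj_br (bilinear_subr ba) opprB.
  by rewrite addrACA -opprD.
(* Only the symmetry of [q] in its last two arguments matters now: it makes the cyclic sum
   telescope. *)
clearbody q; rewrite !G (qC z y x) (qC x z y) (qC y z x).
by rewrite !addrA !subrK subrr.
Qed.

Lemma subadj_calL (bd : is_bilinear dia) (ba : is_bilinear ast) x y z :
  calL smul sbr beta x y z
  = calF1 dia ast beta x y z + calF1 dia ast beta x z y
    + calF2 dia ast beta y z x.
Proof.
have E1 : sbr (beta x) (smul y z) = ast (beta x) (dia y z)
    + ast (beta x) (dia z y) - ast (smul y z) (beta x).
  by rewrite {1}/subadj_br {1}/subadj_mul (bilinear_addr ba).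
have E2 u v w : smul (beta u) (sbr v w)
    = dia (beta u) (ast v w) - dia (beta u) (ast w v)
      + dia (sbr v w) (beta u).
  by rewrite {1}/subadj_mul {1}/subadj_br (bilinear_subr bd).
rewrite /calL (subadj_mulC (sbr x y)) E1 !E2 /calF1 /calF2.
rewrite !opprD !opprK.
(* The nine terms regroup into the expansions of the three summands of [calL], in their order. *)
by rewrite [RHS](AC (3*3*3) ((1*4*9)*(5*8*3)*(2*7*6))).
Qed.

Lemma subadj_hom_F_manifold :
  hom_pre_F_manifold_algebra dia ast beta ->
  hom_F_manifold_algebra smul sbr beta.
Proof.
case=> lb [bd zin] [ba plie] F1 F2; split=> //.
- exact: subadj_comm_hom_assoc.
- exact: subadj_hom_Lie.
move=> x y z w.
have F2D u v s t : calF2 dia ast beta u v (s + t)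
    = calF2 dia ast beta u v s + calF2 dia ast beta u v t.
  rewrite /calF2 (linear_add lb) !(bilinear_addr ba).
  rewrite !(bilinear_addr bd).
  by rewrite [RHS]addrACA -opprD [in RHS]addrACA.
(* The second compatibility axiom solved for its [calF2] term, to be applied to both halves of
   [smul x y = dia x y + dia y x]. *)
have F2' s t u v : calF2 dia ast beta (beta u) (beta v) (dia s t)
    = dia (calL smul sbr beta s u v) (beta (beta t))
      + dia (beta (beta s)) (calF2 dia ast beta u v t).
  by rewrite F2 subrK.
have D a u v t : dia a (calL smul sbr beta u v t)
    = dia a (calF1 dia ast beta u v t) + dia a (calF1 dia ast beta u t v)
      + dia a (calF2 dia ast beta v t u).
  by rewrite subadj_calL // !(bilinear_addr bd).
rewrite subadj_calL // !F1 {3}/subadj_mul F2D !F2' {3 4}/subadj_mul !D.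
(* Both sides consist of the same eight terms. Those with [beta (beta x)] on the left of [dia]
   reassemble [dia (beta (beta x)) (calL smul sbr beta y z w)], and the one with it on the right
   completes the product [smul]; likewise for [y]. *)
by rewrite [LHS](AC ((2*2)*(2*2)) (((1*3*6)*7)*((2*4*8)*5))).
Qed.

End Subadjacent.

Section OOperator.
Variables (K : fieldType) (A V : lmodType K).
Variables (mul br : A -> A -> A) (alpha : A -> A).
Variables (rho mu : A -> V -> V) (phi : V -> V) (T : V -> A).
Hypothesis hV : representation mul br alpha rho mu phi.
Hypothesis hT : O_operator mul br alpha rho mu phi T.

Local Notation dia := (fun u v : V => mu (T u) v).
Local Notation ast := (fun u v : V => rho (T u) v).

Lemma O_operator_subadj_mul u v : T (subadj_mul dia u v) = mul (T u) (T v).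
Proof. by rewrite (Oop_mul hT). Qed.

Lemma O_operator_subadj_br u v : T (subadj_br ast u v) = br (T u) (T v).
Proof. by rewrite (Oop_br hT). Qed.

Lemma O_operator_calL x y z :
  T (calL (subadj_mul dia) (subadj_br ast) phi x y z)
  = calL mul br alpha (T x) (T y) (T z).
Proof.
rewrite /calL 2!(linear_sub (Oop_linear hT)).
by rewrite !(O_operator_subadj_mul, O_operator_subadj_br, Oop_phi hT).
Qed.

(** The arguments [x] and [y] act only through their images under [T], which respects brackets and
    twists; [z] stays in [V] as the vector acted on. *)
Lemma O_operator_calF1 x y z :
  calF1 dia ast phi x y z = calL1 br alpha rho mu phi (T x) (T y) z.
Proof. by rewrite /calF1 O_operator_subadj_br !(Oop_phi hT). Qed.

Lemma O_operator_calF2 x y z :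
  calF2 dia ast phi x y z = calL2 mul alpha rho mu phi (T x) (T y) z.
Proof. by rewrite /calF2 O_operator_subadj_mul !(Oop_phi hT). Qed.

Lemma O_operator_bilinear (m : A -> V -> V) :
  is_bilinear m -> is_bilinear (fun u v : V => m (T u) v).
Proof.
move=> [ml mr]; split=> [v|u] a x y; last exact: mr.
by rewrite (Oop_linear hT) ml.
Qed.

Lemma O_operator_hom_pre_F_manifold : hom_pre_F_manifold_algebra dia ast phi.
Proof.
have bd := O_operator_bilinear (rep_mu_bilinear hV).
have ba := O_operator_bilinear (rep_rho_bilinear hV).
split; first exact: rep_phi_linear hV.
(* The Hom-Zinbiel axiom is the law for [mu] at a product: its two right-hand terms add up to
   [dia (subadj_mul dia x y) (phi z)]. *)
- split=> // x y z; rewrite (Oop_phi hT) -(rep_mu_mul hV).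
  by rewrite -(bilinear_addl bd) addrC -O_operator_subadj_mul.
- split=> // x y z.
  (* Splitting the bracket in the law for [rho] gives the four terms of the Hom-pre-Lie axiom, up to
     moving them across the equality. *)
  have := rep_rho_br hV (T x) (T y) z.
  rewrite -O_operator_subadj_br (bilinear_subl ba) !(Oop_phi hT).
  move/eqP; rewrite subr_eq => /eqP ->.
  by rewrite addrC !addrA addNr add0r addrC.
- move=> x y z w; rewrite !O_operator_calF1 O_operator_subadj_mul !(Oop_phi hT).
  exact: rep_L1 hV _ _ _ _.
- move=> x y z w; rewrite !O_operator_calF2 O_operator_calL !(Oop_phi hT).
  exact: rep_L2 hV _ _ _ _.
Qed.

Lemma O_operator_hom :
  hom_F_manifold_hom (subadj_mul dia) (subadj_br ast) phi mul br alpha T.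
Proof.
split; [exact: Oop_linear hT | exact: Oop_phi hT | |].
- exact: O_operator_subadj_mul.
- exact: O_operator_subadj_br.
Qed.

End OOperator.

(** [hom_F_manifold_hom] records only linearity and compatibility with the operations, so the middle
    clause states separately that the source of [T] is a Hom-F-manifold algebra. *)
Theorem theorem4p17 (K : closedFieldType) (charK : [pchar K] =i pred0)
    (A V : lmodType K)
    (mul br : A -> A -> A) (alpha : A -> A)
    (rho mu : A -> V -> V) (phi : V -> V) (T : V -> A)
    (hA : hom_F_manifold_algebra mul br alpha)
    (hV : representation mul br alpha rho mu phi)
    (hT : O_operator mul br alpha rho mu phi T) :
  let dia := fun u v : V => mu (T u) v in
  let ast := fun u v : V => rho (T u) v in
  [/\ hom_pre_F_manifold_algebra dia ast phi,
      hom_F_manifold_algebra (subadj_mul dia) (subadj_br ast) phi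
    & hom_F_manifold_hom (subadj_mul dia) (subadj_br ast) phi
                         mul br alpha T].
Proof.
move=> dia ast.
have hP := O_operator_hom_pre_F_manifold hV hT.
split; [exact: hP | exact: subadj_hom_F_manifold | exact: O_operator_hom hT].
Qed.
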